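(* Assume the location-scale assumption holds with standardized variable $\xi$. Let $\rho_{M}$ denote either of the estimators $\rho_{\mathrm{Delta}}$ or $\rho_{\mathrm{OIC}}$. Then: (i) if the losses have an unbounded right tail (i.e. $\mathbb{P}(\xi\ge y)>0$ for every $y\in\mathbb{R}$), then $\rho_{\mathbb{P}}(\ell(z,\eta))-\mathbb{E}[\rho_M]=\omega\big(\sqrt{\mathrm{Var}(\ell(z,\eta))}\big)$; (ii) if the losses are normally distributed, then $\rho_{\mathbb{P}}(\ell(z,\eta))-\mathbb{E}[\rho_M]=\Omega\big(\mathrm{Var}(\ell(z,\eta))\big)$; (iii) if $\xi$ follows the Laplace distribution with density $\frac1{\sqrt2}e^{-\sqrt2|x|}$, then $\rho_{\mathbb{P}}(\ell(z,\eta))-\mathbb{E}[\rho_M]\to\infty$ as $\mathrm{Var}(\ell(z,\eta))\to2/\alpha^2$; (iv) if the losses have subgaussian tails (equivalently, $\xi$ does), then $\big|\rho_{\mathbb{P}}(\ell(z,\eta))-\mathbb{E}[\rho_M]\big|=\mathcal{O}\big(\mathrm{Var}(\ell(z,\eta))\big)$.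
   Context: Fix a risk aversion parameter $\alpha>0$ and an integer $N\ge 1$. $\mathcal{Z}\subseteq\mathbb{R}^d$ is a set of decisions, $\eta$ is a random vector with law $\mathbb{P}$, and $\ell(z,\eta)$ is a real random loss for each $z\in\mathcal{Z}$. The entropic risk is $\rho_{\mathbb{P}}(X)=\frac1\alpha\log\mathbb{E}_{\mathbb{P}}[\exp(\alpha X)]\in(-\infty,+\infty]$. Given i.i.d. samples $\hat\eta_1,\dots,\hat\eta_N$ from $\mathbb{P}$ with empirical distribution $\hat{\mathbb{P}}_N$, the empirical entropic risk is $\rho_{\hat{\mathbb{P}}_N}(\ell(z,\eta))=\frac1\alpha\log\big(\frac1N\sum_{i=1}^N\exp(\alpha\ell(z,\hat\eta_i))\big)$; the expectation $\mathbb{E}$ in the claim is over the samples. Define $$\rho_{\mathrm{Delta}}:=\rho_{\hat{\mathbb{P}}_N}(\ell(z,\eta))+\frac{\mathrm{Var}_{\hat{\mathbb{P}}_N}(\exp(\alpha\ell(z,\eta)))}{2\alpha N(\mathbb{E}_{\hat{\mathbb{P}}_N}[\exp(\alpha\ell(z,\eta))])^2},\qquad \rho_{\mathrm{OIC}}:=\rho_{\hat{\mathbb{P}}_N}(\ell(z,\eta))+\frac{\mathrm{Var}_{\hat{\mathbb{P}}_N}(\exp(\alpha\ell(z,\eta)))}{\alpha N(\mathbb{E}_{\hat{\mathbb{P}}_N}[\exp(\alpha\ell(z,\eta))])^2},$$ where mean and variance are those of the empirical distribution. Location-scale assumption: there are a fixed real random variable $\xi$ with $\mathbb{E}[\xi]=0$,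 $\mathbb{E}[\xi^2]=1$ and a set $\mathcal{A}\subset\mathbb{R}\times\mathbb{R}_+$ such that the set of distributions of $\{\ell(z,\eta):z\in\mathcal{Z}\}$ equals the set of distributions of $\{\mu+\sigma\xi:(\mu,\sigma)\in\mathcal{A}\}$. A random variable $X$ has subgaussian tails if there is $\mathfrak{c}_0>0$ with $\mathbb{P}(|X|\ge a)\le 2\exp(-a^2/\mathfrak{c}_0^2)$ for all $a\ge0$. Asymptotic notation: $\alpha$, $N$ and the law of $\xi$ are fixed, and quantities are considered as $\sigma=\sqrt{\mathrm{Var}(\ell(z,\eta))}$ varies. $f=\mathcal{O}(g(\sigma))$: there are $c,\bar\sigma>0$ with $f\le c\,g(\sigma)$ whenever $\sigma\ge\bar\sigma$. $f=\Omega(g(\sigma))$: there are $c,\bar\sigma>0$ with $c\,g(\sigma)\le f$ whenever $\sigma\ge\bar\sigma$. $f=\omega(g(\sigma))$: for every $c>0$ there is $\bar\sigma>0$ with $c\,g(\sigma)\le f$ whenever $\sigma\ge\bar\sigma$. *)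

(* Defs.v *)
From HB Require Import structures.
From mathcomp Require Import all_boot all_order all_algebra.
From mathcomp Require Import all_classical all_reals all_analysis.

Set Implicit Arguments.
Unset Strict Implicit.
Unset Printing Implicit Defensive.

Import Order.TTheory GRing.Theory Num.Theory.
Import numFieldNormedType.Exports.

Local Open Scope classical_set_scope.
Local Open Scope ring_scope.

(* Laws are compared on measurable sets only: a measure is a total function on
   [set T], but its values outside the sigma-algebra carry no meaning. *)
Definition has_law (R : realType) (d d' : measure_display)
    (T : measurableType d) (T' : measurableType d') (P : probability T R)
    (X : T -> T') (mu : set T' -> \bar R) : Prop :=
  forall B : set T', measurable B -> P (X @^-1` B) = mu B.

Definition same_law (R : realType) (d1 d2 : measure_display)
    (T1 : measurableType d1) (T2 : measurableType d2)
    (P1 : probability T1 R) (X1 : T1 -> R)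
    (P2 : probability T2 R) (X2 : T2 -> R) : Prop :=
  has_law P1 X1 (pushforward P2 X2).

Definition mutually_independent (R : realType) (d d' : measure_display)
    (O : measurableType d) (E : measurableType d') (Q : probability O R)
    (n : nat) (X : 'I_n -> O -> E) : Prop :=
  forall (J : {set 'I_n}) (B : 'I_n -> set E),
    (forall i, measurable (B i)) ->
    Q (\bigcap_(i in [set i | i \in J]) (X i @^-1` B i))
    = (\prod_(i in J) Q (X i @^-1` B i))%E.

(* [E] carries the law [dp_P] of the random vector, so expectations over [dp_P]
   of [dp_loss z] are those of the loss; [dp_sample] are the data, random
   elements on a probability space of their own. *)
Record decision_problem (R : realType) (N : nat) := DecisionProblem {
  dp_dim : nat;
  dp_Z : set 'rV[R]_dp_dim;
  dp_dispE : measure_display;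
  dp_E : measurableType dp_dispE;
  dp_P : probability dp_E R;
  dp_loss : 'rV[R]_dp_dim -> dp_E -> R;
  dp_loss_measurable : forall z, dp_Z z -> measurable_fun setT (dp_loss z);
  dp_dispO : measure_display;
  dp_O : measurableType dp_dispO;
  dp_Q : probability dp_O R;
  dp_sample : 'I_N -> {RV dp_Q >-> dp_E};
  dp_sample_law : forall i, has_law dp_Q (dp_sample i) dp_P;
  dp_sample_indep : mutually_independent dp_Q dp_sample
}.
Arguments dp_Z {R N} _ _.
Arguments dp_loss {R N} _ _ _.

Record decision (R : realType) (N : nat) := Decision {
  dec_problem : decision_problem R N;
  dec_point : 'rV[R]_(dp_dim dec_problem);
  dec_feasible : dp_Z dec_problem dec_point
}.

Definition location_scale (R : realType) (N : nat) (d : measure_display)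
    (S : measurableType d) (Pxi : probability S R) (xi : S -> R)
    (p : decision_problem R N) : Prop :=
  exists A : set (R * R),
    [/\ forall ms, A ms -> 0 <= ms.2,
        forall z, dp_Z p z -> exists2 ms : R * R, A ms &
          same_law (dp_P p) (dp_loss p z) Pxi (fun s => ms.1 + ms.2 * xi s)
      & forall ms : R * R, A ms -> exists2 z, dp_Z p z &
          same_law (dp_P p) (dp_loss p z) Pxi (fun s => ms.1 + ms.2 * xi s)].

Definition entropic_risk (R : realType) (alpha : R) (d : measure_display)
    (T : measurableType d) (P : probability T R) (X : T -> R) : \bar R :=
  (alpha^-1%:E * lne 'E_P[fun w => expR (alpha * X w)])%E.

(* [x : 'I_N -> R] is the vector of observed losses. *)
Section Empirical.
Context {R : realType} {N : nat}.
Implicit Types (alpha : R) (x y : 'I_N -> R).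

Definition emp_mean y : R := N%:R^-1 * \sum_(i < N) y i.

Definition emp_var y : R := emp_mean (fun i => (y i - emp_mean y) ^+ 2).

Definition emp_entropic_risk alpha x : R :=
  alpha^-1 * ln (emp_mean (fun i => expR (alpha * x i))).

Definition rho_Delta alpha x : R :=
  let e i := expR (alpha * x i) in
  emp_entropic_risk alpha x
  + emp_var e / (2 * alpha * N%:R * emp_mean e ^+ 2).

Definition rho_OIC alpha x : R :=
  let e i := expR (alpha * x i) in
  emp_entropic_risk alpha x
  + emp_var e / (alpha * N%:R * emp_mean e ^+ 2).

End Empirical.

Definition loss_of (R : realType) (N : nat) (c : decision R N) :
    dp_E (dec_problem c) -> R :=
  dp_loss (dec_problem c) (dec_point c).
Arguments loss_of {R N} c _.

Section DecisionQuantities.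
Context {R : realType} {N : nat}.
Implicit Types (c : decision R N).

Definition loss_var c : R := fine 'V_(dp_P (dec_problem c))[loss_of c].

Definition loss_sd c : R := Num.sqrt (loss_var c).

(* True risk minus the expected estimate, the expectation being over samples. *)
Definition risk_gap (alpha : R) (rhoM : ('I_N -> R) -> R) c : \bar R :=
  (entropic_risk alpha (dp_P (dec_problem c)) (loss_of c)
   - 'E_(dp_Q (dec_problem c))
        [fun w => rhoM (fun i => loss_of c (dp_sample (dec_problem c) i w))])%E.

End DecisionQuantities.

Section TailConditions.
Context {R : realType} {d : measure_display} {T : measurableType d}.
Variables (P : probability T R) (X : T -> R).

Definition unbounded_right_tail : Prop :=
  forall y : R, (0 < P [set w | (y <= X w)%R])%E.

Definition subgaussian_tails : Prop :=
  exists2 c0 : R, 0 < c0 & forall a : R, 0 <= a ->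
    (P [set w | (a <= `|X w|)%R] <= (2 * expR (- (a ^+ 2 / c0 ^+ 2)))%R%:E)%E.

(* [normal_prob m 0] is not a point mass in the library (it is uniform on
   [0, 1]), so the degenerate normal laws are listed separately. *)
Definition normally_distributed : Prop :=
  (exists m s : R, 0 < s /\ has_law P X (normal_prob m s)) \/
  (exists m : R, has_law P X \d_m).

Definition standardized_laplace : Prop :=
  has_law P X (fun B : set R => \int[lebesgue_measure]_(x in B)
    ((Num.sqrt 2)^-1 * expR (- (Num.sqrt 2 * `|x|)))%R%:E)%E.

End TailConditions.

Definition losses_normal (R : realType) (N : nat) (p : decision_problem R N) :=
  forall z, dp_Z p z -> normally_distributed (dp_P p) (dp_loss p z).

Definition losses_subgaussian (R : realType) (N : nat)
    (p : decision_problem R N) :=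
  forall z, dp_Z p z -> subgaussian_tails (dp_P p) (dp_loss p z).

(* Asymptotics as the scale [sigma] grows, for quantities indexed by [I] and
   restricted to the class [D]; the constants are uniform over [D]. *)
Section Asymptotics.
Context {R : realType} {I : Type}.
Variables (D : I -> Prop) (sigma : I -> R) (f : I -> \bar R) (g : I -> R).

Definition asymp_bigO : Prop :=
  exists c sbar : R, [/\ 0 < c, 0 < sbar &
    forall i, D i -> sbar <= sigma i -> (f i <= (c * g i)%:E)%E].

Definition asymp_bigOmega : Prop :=
  exists c sbar : R, [/\ 0 < c, 0 < sbar &
    forall i, D i -> sbar <= sigma i -> ((c * g i)%:E <= f i)%E].

Definition asymp_littleomega : Prop :=
  forall c : R, 0 < c -> exists2 sbar : R, 0 < sbar &
    forall i, D i -> sbar <= sigma i -> ((c * g i)%:E <= f i)%E.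

(* [f] tends to +oo as the real quantity [g] tends to [v0]. *)
Definition tends_to_pinfty (v0 : R) : Prop :=
  forall K : R, \forall v \near v0^',
    forall i, D i -> g i = v -> (K%:E <= f i)%E.

End Asymptotics.

(* Main.v *)
Require Import Defs.
From HB Require Import structures.
From mathcomp Require Import all_boot all_order all_algebra.
From mathcomp Require Import all_classical all_reals all_analysis.
From mathcomp Require Import measurable_realfun ring lra.

(** A loss in the location-scale family has the law of m + s xi, where s is its
    standard deviation, so its entropic risk is m + ln M(alpha s) / alpha with
    M(t) = E[exp(t xi)].  The estimator, in contrast, never moves far from the
    sample: the empirical entropic risk lies between the smallest and the
    largest observed loss, and either correction term is between 0 and
    N / alpha because the empirical variance of nonnegative numbers is at most
    the square of their sum.  Hence |rho_M - m| is at most the sum of the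
    |x_i - m| plus N / alpha [corrected_risk_near], and, as E|xi| <= 1,
    its expectation is m + r with |r| <= N s + N / alpha.  The location cancels
    in the gap, which is ln M(alpha s) / alpha - r [location_scale_gap].

    Everything is thereby reduced to the growth of ln M, since the error r is
    only linear in s:
    - an unbounded right tail gives M(t) >= exp(t y) P(xi >= y) for every y, so
      ln M(t) grows faster than any multiple of t;
    - for a normal loss ln M is at least a positive multiple of t^2, up to an
      affine error [normal_mgf_ge];
    - for the Laplace law M(t) becomes unbounded as t tends to sqrt 2, each of
      the first n unit cells contributing a fixed amount to E[exp(t xi)] as
      soon as t >= sqrt 2 - 1/n [laplace_mgf_ge];
    - for a subgaussian loss ln M is at most a multiple of t^2, up to an affine
      error [subgaussian_mgf_le], while M(t) >= 1 since xi is centred.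

    Normality and subgaussianity are assumed of the losses, whereas the
    constants must be uniform over all of them.  This is resolved by picking
    one nondegenerate loss X, with law m + s xi: it determines the moment
    generating function of xi by M(t) = exp(-t m / s) E[exp((t / s) X)], and
    if every loss is degenerate, the threshold 1 on s leaves nothing to prove. *)

Import Order.TTheory GRing.Theory Num.Theory.
Import numFieldNormedType.Exports.

Local Open Scope classical_set_scope.
Local Open Scope ring_scope.

(** * Distance from the estimators to the location *)

Section EstimatorBounds.
Context {R : realType} {N : nat}.
Hypothesis N_gt0 : (0 < N)%N.
Implicit Types (x y : 'I_N -> R).

Lemma emp_mean_le y b : (forall i, y i <= b) -> emp_mean y <= b.
Proof.
move=> yb; rewrite /emp_mean mulrC ler_pdivrMr ?ltr0n//.
rewrite mulr_natr -[N in X in _ <= X]card_ord -sumr_const.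
exact: ler_sum.
Qed.

Lemma emp_mean_ge y b : (forall i, b <= y i) -> b <= emp_mean y.
Proof.
move=> yb; rewrite /emp_mean mulrC ler_pdivlMr ?ltr0n//.
rewrite mulr_natr -[N in X in X <= _]card_ord -sumr_const.
exact: ler_sum.
Qed.

Lemma emp_mean_gt0 y : (forall i, 0 < y i) -> 0 < emp_mean y.
Proof.
move=> y0; rewrite /emp_mean mulr_gt0 ?invr_gt0 ?ltr0n//.
by rewrite (bigD1 (Ordinal N_gt0))//= ltr_wpDr// sumr_ge0// => i _; rewrite ltW.
Qed.

Lemma emp_var_ge0 y : 0 <= emp_var y.
Proof. by apply: emp_mean_ge => i; exact: sqr_ge0. Qed.

(** Each y_i and the mean itself lie between 0 and the sum N * emp_mean y, so
    every deviation is bounded by that sum. *)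
Lemma emp_var_le y : (forall i, 0 <= y i) ->
  emp_var y <= (N%:R * emp_mean y) ^+ 2.
Proof.
move=> y0; apply: emp_mean_le => i.
have N1 : 1 <= N%:R :> R by rewrite ler1n.
have m0 : 0 <= emp_mean y by exact: emp_mean_ge.
have Nm : N%:R * emp_mean y = \sum_(j < N) y j.
  by rewrite /emp_mean mulrA divff ?mul1r// pnatr_eq0 -lt0n.
have yi : y i <= N%:R * emp_mean y.
  by rewrite Nm (bigD1 i)//= lerDl sumr_ge0.
have := y0 i; set m := emp_mean y in m0 yi *; set b := _ * m in yi *.
have mb : m <= b by rewrite /b ler_peMl.
move=> yi0; rewrite -real_normK ?num_real// ler_pXn2r ?nnegrE//; last first.
  by rewrite (le_trans m0).
by rewrite ler_norml; lra.
Qed.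

Section WithAlpha.
Variable alpha : R.
Hypothesis alpha_gt0 : 0 < alpha.

(** The empirical entropic risk is a quasi-arithmetic mean, hence it stays in
    every interval that contains the observations. *)
Lemma emp_entropic_risk_near x m S : (forall i, `|x i - m| <= S) ->
  `|emp_entropic_risk alpha x - m| <= S.
Proof.
move=> xS.
have lo i : expR (alpha * (m - S)) <= expR (alpha * x i).
  by rewrite ler_expR ler_pM2l//; have := xS i; rewrite ler_norml; lra.
have hi i : expR (alpha * x i) <= expR (alpha * (m + S)).
  by rewrite ler_expR ler_pM2l//; have := xS i; rewrite ler_norml; lra.
have := emp_mean_ge _ _ lo; have := emp_mean_le _ _ hi.
rewrite /emp_entropic_risk; set M := emp_mean _ => Mhi Mlo.
have M0 : 0 < M by rewrite (lt_le_trans _ Mlo)// expR_gt0.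
have lnhi : alpha^-1 * ln M <= m + S.
  by rewrite mulrC ler_pdivrMr// mulrC -ler_expR lnK.
have lnlo : m - S <= alpha^-1 * ln M.
  by rewrite mulrC ler_pdivlMr// mulrC -ler_expR lnK.
by rewrite ler_norml; lra.
Qed.

(** The cases k = 2 and k = 1 are the corrections of the two estimators. *)
Lemma correction_bounds (k : R) x : 1 <= k ->
  0 <= emp_var (fun i => expR (alpha * x i)) /
      (k * alpha * N%:R * emp_mean (fun i => expR (alpha * x i)) ^+ 2)
    <= N%:R / alpha.
Proof.
pose e i := expR (alpha * x i); move=> k1; rewrite -/e.
have N0 : 0 < N%:R :> R by rewrite ltr0n.
have e0 i : 0 <= e i by exact: expR_ge0.
have m0 : 0 < emp_mean e by apply: emp_mean_gt0 => i; exact: expR_gt0.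
have d0 : 0 < k * alpha * N%:R * emp_mean e ^+ 2.
  have k0 : 0 < k := lt_le_trans ltr01 k1.
  by apply: mulr_gt0; [rewrite !mulr_gt0|rewrite exprn_gt0].
rewrite divr_ge0 ?emp_var_ge0 ?(ltW d0)//= ler_pdivrMr//.
rewrite (le_trans (emp_var_le _ e0))//.
have -> : N%:R / alpha * (k * alpha * N%:R * emp_mean e ^+ 2) =
  k * (N%:R * emp_mean e) ^+ 2 by field; rewrite gt_eqF.
by rewrite ler_peMl// sqr_ge0.
Qed.

(** The total deviation of the sample is used instead of its maximum because
    its expectation is a sum of expectations over the law of a single loss. *)
Lemma corrected_risk_near rhoM x m :
    rhoM = rho_Delta alpha \/ rhoM = rho_OIC alpha ->
  `|rhoM x - m| <= \sum_(i < N) `|x i - m| + N%:R / alpha.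
Proof.
move=> rhoE.
have [k k1 ->] : exists2 k, 1 <= k & rhoM x = emp_entropic_risk alpha x +
    emp_var (fun i => expR (alpha * x i)) /
      (k * alpha * N%:R * emp_mean (fun i => expR (alpha * x i)) ^+ 2).
  case: rhoE => ->; first by exists 2; rewrite ?ler1n.
  by exists 1 => //; rewrite mul1r.
have := correction_bounds k x k1; set c := _ / _ => /andP[c0 cN].
have : `|emp_entropic_risk alpha x - m| <= \sum_(i < N) `|x i - m|.
  apply: emp_entropic_risk_near => i; rewrite (bigD1 i)//= lerDl.
  by rewrite sumr_ge0.
by rewrite !ler_norml; lra.
Qed.

End WithAlpha.
End EstimatorBounds.

Section Measurability.
Context {R : realType} {N : nat} {d : measure_display} {T : measurableType d}.

Lemma measurable_emp_mean (y : T -> 'I_N -> R) :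
  (forall i, measurable_fun setT (fun w => y w i)) ->
  measurable_fun setT (fun w => emp_mean (y w)).
Proof.
move=> my; apply: measurable_funM => //.
exact: (@measurable_sum _ _ _ _ _ _ (fun i w => y w i)).
Qed.

Lemma measurable_emp_var (y : T -> 'I_N -> R) :
  (forall i, measurable_fun setT (fun w => y w i)) ->
  measurable_fun setT (fun w => emp_var (y w)).
Proof.
move=> my; apply: (measurable_emp_mean (fun w i => (y w i - emp_mean (y w)) ^+ 2)).
move=> i; apply: measurable_funX; apply: measurable_funB => //.
exact: measurable_emp_mean.
Qed.

Lemma measurable_corrected_risk (alpha : R) (rhoM : ('I_N -> R) -> R)
    (x : T -> 'I_N -> R) : (0 < N)%N ->
    rhoM = rho_Delta alpha \/ rhoM = rho_OIC alpha ->
    (forall i, measurable_fun setT (fun w => x w i)) ->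
  measurable_fun setT (fun w => rhoM (x w)).
Proof.
move=> N_gt0 rhoE mx.
have me i : measurable_fun setT (fun w => expR (alpha * x w i)).
  by apply: measurableT_comp => //; exact: measurable_funM.
have mm := measurable_emp_mean _ me.
have mv := measurable_emp_var _ me.
have [k ->] : exists k, rhoM = fun x => emp_entropic_risk alpha x +
    emp_var (fun i => expR (alpha * x i)) /
      (k * emp_mean (fun i => expR (alpha * x i)) ^+ 2).
  by case: rhoE => ->; eexists; apply/funext.
apply: measurable_funD.
  by apply: measurable_funM => //; exact: measurableT_comp.
apply: measurable_funM => //.
(* The denominator is positive, so its inverse is the exponential of minus its
   logarithm, a composition of measurable functions. *)
rewrite (_ : (fun _ => _) = fun w =>
  k^-1 * expR (- (2 * ln (emp_mean (fun i => expR (alpha * x w i)))))); last first.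
  apply/funext => w; rewrite invfM expRN; congr (_ * _^-1).
  by rewrite mulrC expRM_natr lnK// posrE emp_mean_gt0// => i; rewrite expR_gt0.
apply: measurable_funM => //; apply: measurableT_comp => //.
by apply: measurableT_comp => //; apply: measurable_funM => //; exact: measurableT_comp.
Qed.

End Measurability.

(** * Integrals and laws *)

Section Transfer.
Context {R : realType}.
Local Open Scope ereal_scope.

(** Both sides split into the integrals of the positive and negative parts, to
    which the change of variables for nonnegative functions applies. *)
Lemma has_law_integral {d d'} {T : measurableType d} {T' : measurableType d'}
    {P : probability T R} {X : T -> T'} {mu : {measure set T' -> \bar R}}
    {f : T' -> \bar R} :
    measurable_fun setT X -> has_law P X mu -> measurable_fun setT f ->
  \int[P]_w f (X w) = \int[mu]_y f y.
Proof.
move=> mX lawX mf.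
pose Xm : {mfun T >-> T'} := HB.pack X (isMeasurableFun.Build _ _ _ _ _ mX).
have ge0 (g : T' -> \bar R) : measurable_fun setT g -> (forall y, 0 <= g y) ->
    \int[P]_w g (X w) = \int[mu]_y g y.
  move=> mg g0; rewrite -(ge0_integral_distribution Xm mg g0).
  by apply: eq_measure_integral => B mB _; exact: lawX.
rewrite [LHS]integralE [RHS]integralE; congr (_ - _).
  rewrite -(ge0 _ (measurable_funepos mf)) ?funepos_ge0//.
  by rewrite (funepos_comp f X).
rewrite -(ge0 _ (measurable_funeneg mf)) ?funeneg_ge0//.
by rewrite (funeneg_comp f X).
Qed.

Lemma same_law_integral {d1 d2} {T1 : measurableType d1} {T2 : measurableType d2}
    {P1 : probability T1 R} {P2 : probability T2 R} {X1 : T1 -> R} {X2 : T2 -> R}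
    {f : R -> \bar R} :
    measurable_fun setT X1 -> measurable_fun setT X2 -> same_law P1 X1 P2 X2 ->
    measurable_fun setT f ->
  \int[P1]_w f (X1 w) = \int[P2]_w f (X2 w).
Proof.
move=> mX1 mX2 X12 mf.
pose X2m : {RV P2 >-> R} := HB.pack X2 (isMeasurableFun.Build _ _ _ _ _ mX2).
have lawX2 : has_law P2 X2 (distribution P2 X2m) by [].
by rewrite (has_law_integral mX2 lawX2 mf) -(has_law_integral mX1 X12 mf).
Qed.

(** Gives integrability of f and the position of its mean at the same time. *)
Lemma integral_near {d} {T : measurableType d} {P : probability T R}
    {f : T -> R} {m b : R} : measurable_fun setT f ->
    \int[P]_w `|f w - m|%:E <= b%:E ->
  exists2 r : R, (`|r| <= b)%R & \int[P]_w (f w)%:E = (m + r)%:E.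
Proof.
move=> mf fmb.
have mfm : measurable_fun setT (fun w => (f w - m)%:E).
  by apply/measurable_EFinP; exact: measurable_funB.
have ifm : P.-integrable setT (fun w => (f w - m)%:E).
  by apply/integrableP; split => //; exact: le_lt_trans fmb (ltry _).
have := le_trans (le_abse_integral P measurableT mfm) fmb.
have := integrable_fin_num measurableT ifm.
case E : (\int[P]_w (f w - m)%:E) => [r||]//= _ rb.
exists r => //.
rewrite (_ : (fun w => (f w)%:E) = (fun w => (f w - m)%:E + m%:E)); last first.
  by apply/funext => w; rewrite -EFinD subrK.
rewrite integralD//; last exact: finite_measure_integrable_cst.
by rewrite integral_cst//= probability_setT mule1 [X in X + _]E EFinD addeC.
Qed.

End Transfer.

(** * Moments in the location-scale family *)

Section Standardized.
Context {R : realType} {d : measure_display} {S : measurableType d}.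
Context {Pxi : probability S R} {xi : {RV Pxi >-> R}}.
Hypothesis xi_mean : ('E_Pxi[xi] = 0)%E.
Hypothesis xi_second_moment : ('E_Pxi[fun s => (xi s ^+ 2)%R] = 1)%E.
Local Open Scope ereal_scope.

(** Integrate |x| <= (1 + x^2) / 2. *)
Lemma standardized_abs_le1 : \int[Pxi]_s `|xi s|%:E <= 1.
Proof.
have mxi2 : measurable_fun setT (fun s => (xi s ^+ 2)%:E).
  by apply/measurable_EFinP; exact: measurable_funX.
apply: (@le_trans _ _ (\int[Pxi]_s (2^-1%:E * (1 + (xi s ^+ 2)%:E)))).
  apply: ge0_le_integral => //.
  - by apply/measurable_EFinP; exact: measurableT_comp.
  - by apply: emeasurable_funM => //; exact: emeasurable_funD.
  - move=> s _; rewrite -EFinD -EFinM lee_fin -(@real_normK _ (xi s)) ?num_real//.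
    by have := sqr_ge0 (`|xi s| - 1)%R; nra.
rewrite ge0_integralZl_EFin//; last 2 first.
- by move=> s _; rewrite adde_ge0// lee_fin sqr_ge0.
- exact: emeasurable_funD.
rewrite ge0_integralD//; last by move=> s _; rewrite lee_fin sqr_ge0.
move: xi_second_moment; rewrite unlock => ->.
rewrite integral_cst//= probability_setT mule1 -EFinD -EFinM lee_fin.
by rewrite mulVf.
Qed.

Lemma standardized_integrable : Pxi.-integrable setT (fun s => (xi s)%:E).
Proof.
apply/integrableP; split; first exact/measurable_EFinP.
exact: le_lt_trans standardized_abs_le1 (ltry _).
Qed.

Lemma integral_affine a b : \int[Pxi]_s (a + b * xi s)%:E = a%:E.
Proof.
under eq_integral do rewrite EFinD EFinM.
rewrite integralD//; [|exact: finite_measure_integrable_cst|].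
  rewrite integralZl//; last exact: standardized_integrable.
  move: xi_mean; rewrite unlock => ->.
  by rewrite mule0 adde0 integral_cst//= probability_setT mule1.
by apply: integrableZl => //; exact: standardized_integrable.
Qed.

Context {d' : measure_display} {T : measurableType d'} {P : probability T R}.
Context {X : T -> R} {m s : R}.
Hypothesis mX : measurable_fun setT X.
Hypothesis s_ge0 : (0 <= s)%R.
Hypothesis lawX : same_law P X Pxi (fun w => m + s * xi w)%R.

Let maff : measurable_fun setT (fun w => m + s * xi w)%R.
Proof. by apply: measurable_funD => //; exact: measurable_funM. Qed.

Lemma same_law_affine_mean : 'E_P[X] = m%:E.
Proof.
rewrite unlock (same_law_integral mX maff lawX); last exact/measurable_EFinP.
exact: integral_affine.
Qed.

Lemma same_law_affine_variance : 'V_P[X] = (s ^+ 2)%:E.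
Proof.
have mf : measurable_fun setT (fun x : R => ((x - m) * (x - m))%:E).
  by apply/measurable_EFinP; apply: measurable_funM; exact: measurable_funB.
rewrite /variance unlock same_law_affine_mean/= unlock.
rewrite [LHS](same_law_integral mX maff lawX mf).
have -> : (fun w => ((m + s * xi w - m) * (m + s * xi w - m))%:E) =
    (fun w => (s ^+ 2)%:E * (xi w ^+ 2)%:E).
  by apply/funext => w; rewrite -EFinM; congr _%:E; ring.
rewrite ge0_integralZl_EFin ?sqr_ge0//; last 2 first.
- by move=> w _; rewrite lee_fin sqr_ge0.
- by apply/measurable_EFinP; exact: measurable_funX.
by move: xi_second_moment; rewrite unlock => ->; rewrite mule1.
Qed.

Lemma same_law_affine_dist_mean : \int[P]_w `|X w - m|%:E <= s%:E.
Proof.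
have mf : measurable_fun setT (fun x : R => `|x - m|%:E).
  apply/measurable_EFinP; apply: measurableT_comp => //; exact: measurable_funB.
rewrite (same_law_integral mX maff lawX mf).
have -> : (fun w => `|m + s * xi w - m|%:E) = (fun w => s%:E * `|xi w|%:E).
  by apply/funext => w; rewrite -EFinM addrAC subrr add0r normrM ger0_norm.
rewrite ge0_integralZl_EFin//; last first.
  by apply/measurable_EFinP; exact: measurableT_comp.
by rewrite -[leRHS]mule1 lee_pmul// ?integral_ge0// standardized_abs_le1.
Qed.

Lemma same_law_affine_mgf t :
  'E_P[fun w => expR (t * X w)] =
  (expR (t * m))%:E * 'E_Pxi[fun w => expR (t * s * xi w)].
Proof.
have mf : measurable_fun setT (fun x : R => (expR (t * x))%:E).
  by apply/measurable_EFinP; apply: measurableT_comp => //; exact: measurable_funM.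
rewrite !unlock (same_law_integral mX maff lawX mf).
rewrite -ge0_integralZl_EFin ?expR_ge0//.
- by apply: eq_integral => w _; rewrite -EFinM -expRD; congr (expR _)%:E; ring.
- apply/measurable_EFinP; apply: measurableT_comp => //; exact: measurable_funM.
Qed.

End Standardized.

(** * The gap in terms of the moment generating function *)

Section Gap.
Context {R : realType} {d : measure_display} {S : measurableType d}.
Context {Pxi : probability S R} {xi : {RV Pxi >-> R}}.
Hypothesis xi_mean : ('E_Pxi[xi] = 0)%E.
Hypothesis xi_second_moment : ('E_Pxi[fun s => (xi s ^+ 2)%R] = 1)%E.
Local Open Scope ereal_scope.

(** Integrate exp(x) >= 1 + x, the mean of xi being 0. *)
Lemma standardized_mgf_ge1 t : 1 <= 'E_Pxi[fun s => expR (t * xi s)].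
Proof.
have me : measurable_fun setT (fun s => (expR (t * xi s))%:E).
  by apply/measurable_EFinP; apply: measurableT_comp => //; exact: measurable_funM.
rewrite unlock -[leLHS](integral_affine xi_mean xi_second_moment 1 t).
have [inf|fin] := eqVneq (\int[Pxi]_s (expR (t * xi s))%:E) +oo.
  by rewrite inf leey.
apply: le_integral => //.
- rewrite /=; under eq_fun do rewrite EFinD EFinM.
  apply: integrableD => //; first exact: finite_measure_integrable_cst.
  apply: integrableZl => //; exact: standardized_integrable.
- apply/integrableP; split => //.
  under eq_integral do rewrite gee0_abs ?lee_fin ?expR_ge0//.
  by rewrite ltey.
- by move=> s _; rewrite lee_fin expR_ge1Dx.
Qed.

Lemma location_scale_loss {N : nat} {c : decision R N} :
    location_scale Pxi xi (dec_problem c) ->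
  [/\ loss_var c = (loss_sd c ^+ 2)%R, measurable_fun setT (loss_of c) &
    exists m : R, same_law (dp_P (dec_problem c)) (loss_of c) Pxi
      (fun w => m + loss_sd c * xi w)%R].
Proof.
case=> A [A0 /(_ _ (dec_feasible c)) [[m s] /A0/= s0 lawX] _].
have mX : measurable_fun setT (loss_of c).
  exact: dp_loss_measurable (dec_feasible c).
have V : loss_var c = (s ^+ 2)%R.
  by rewrite /loss_var (same_law_affine_variance xi_mean xi_second_moment mX lawX).
have -> : loss_sd c = s by rewrite /loss_sd V sqrtr_sqr ger0_norm.
by split => //; exists m.
Qed.

Context {N : nat} {alpha : R} {rhoM : ('I_N -> R) -> R}.
Hypothesis alpha_gt0 : (0 < alpha)%R.
Hypothesis N_gt0 : (0 < N)%N.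
Hypothesis rhoM_def : rhoM = rho_Delta alpha \/ rhoM = rho_OIC alpha.

Lemma expected_estimate_near (p : decision_problem R N) (X : dp_E p -> R)
    (m s : R) : measurable_fun setT X ->
    \int[dp_P p]_w `|X w - m|%:E <= s%:E ->
  exists2 r : R, (`|r| <= N%:R * s + N%:R / alpha)%R &
    'E_(dp_Q p)[fun w => rhoM (fun i => X (dp_sample p i w))] = (m + r)%:E.
Proof.
move=> mX Xm.
have mXs i : measurable_fun setT (fun w => X (dp_sample p i w)).
  exact: measurableT_comp.
have mdist (f : dp_O p -> R) : measurable_fun setT f ->
    measurable_fun setT (fun w => `|f w - m|%:E).
  move=> mf; apply/measurable_EFinP; apply: measurableT_comp => //.
  exact: measurable_funB.
have mrho := measurable_corrected_risk alpha rhoM _ N_gt0 rhoM_def mXs.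
rewrite unlock; apply: (integral_near mrho).
apply: (@le_trans _ _ (\int[dp_Q p]_w
    (\sum_(i < N) `|X (dp_sample p i w) - m|%:E + (N%:R / alpha)%:E))).
  apply: ge0_le_integral => //.
  - exact: mdist.
  - by apply: emeasurable_funD => //; apply: emeasurable_sum => i; exact: mdist.
  - move=> w _; rewrite sumEFin -EFinD lee_fin.
    exact: (corrected_risk_near N_gt0 _ alpha_gt0 _ _ _ rhoM_def).
have Na0 : (0 <= N%:R / alpha)%R by rewrite divr_ge0// ltW.
rewrite ge0_integralD//; last 2 first.
- by move=> w _; apply: sume_ge0 => i _; rewrite lee_fin.
- by apply: emeasurable_sum => i; exact: mdist.
rewrite integral_cst//= probability_setT mule1 EFinD leeD2r//.
rewrite ge0_integral_sum//; last by move=> i; exact: mdist.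
rewrite (_ : (N%:R * s)%:E = \sum_(i < N) s%:E); last first.
  by rewrite sumEFin sumr_const card_ord mulr_natl.
apply: lee_sum => i _; rewrite (le_trans _ Xm)//.
have mf : measurable_fun setT (fun e => `|X e - m|%:E).
  apply/measurable_EFinP; apply: measurableT_comp => //; exact: measurable_funB.
by rewrite (has_law_integral _ (dp_sample_law i) mf).
Qed.

Lemma location_scale_gap {c : decision R N} :
    location_scale Pxi xi (dec_problem c) ->
  exists2 r : R, (`|r| <= N%:R * loss_sd c + N%:R / alpha)%R &
    risk_gap alpha rhoM c =
    alpha^-1%:E * lne 'E_Pxi[fun w => expR (alpha * loss_sd c * xi w)] - r%:E.
Proof.
move=> /location_scale_loss[_ mX [m lawX]].
have s0 : (0 <= loss_sd c)%R by exact: sqrtr_ge0.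
have [r rb E] := expected_estimate_near _ _ _ _ mX
  (same_law_affine_dist_mean xi_second_moment mX s0 lawX).
exists r => //; rewrite /risk_gap E /entropic_risk (same_law_affine_mgf mX lawX).
have := standardized_mgf_ge1 (alpha * loss_sd c).
case: ('E_Pxi[fun w => _]) => [x||]//.
- rewrite lee_fin => x1.
  have x0 : (0 < x)%R by exact: lt_le_trans ltr01 x1.
  rewrite -EFinM !lne_EFin ?mulr_gt0 ?expR_gt0//.
  rewrite lnM ?posrE ?expR_gt0// expRK -!EFinM -!EFinB; congr _%:E.
  by field; rewrite gt_eqF.
- move=> _; rewrite gt0_muley ?lte_fin ?expR_gt0//=.
  by rewrite gt0_muley// lte_fin invr_gt0.
Qed.

End Gap.

Section GapBounds.
Context {R : realType} {d : measure_display} {S : measurableType d}.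
Context {Pxi : probability S R} {xi : {RV Pxi >-> R}}.
Hypothesis xi_mean : ('E_Pxi[xi] = 0)%E.
Hypothesis xi_second_moment : ('E_Pxi[fun s => (xi s ^+ 2)%R] = 1)%E.
Context {N : nat} {alpha : R} {rhoM : ('I_N -> R) -> R}.
Hypothesis alpha_gt0 : (0 < alpha)%R.
Hypothesis N_gt0 : (0 < N)%N.
Hypothesis rhoM_def : rhoM = rho_Delta alpha \/ rhoM = rho_OIC alpha.
Context {c : decision R N}.
Hypothesis cLS : location_scale Pxi xi (dec_problem c).
Local Open Scope ereal_scope.
Local Notation M t := 'E_Pxi[fun w => expR (t * xi w)].
Local Notation err := (N%:R * loss_sd c + N%:R / alpha)%R.

Let lneK_expR (K : R) : lne (expR K)%:E = K%:E.
Proof. by rewrite lne_EFin ?expR_gt0// expRK. Qed.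

Let itv_ge0 (x : \bar R) : 0 <= x -> x \in `[0, +oo].
Proof. by move=> x0; rewrite in_itv/= x0 leey. Qed.

Lemma risk_gap_ge K : (expR K)%:E <= M (alpha * loss_sd c) ->
  (K / alpha - err)%:E <= risk_gap alpha rhoM c.
Proof.
move=> KM; have [r] := location_scale_gap xi_mean xi_second_moment
  alpha_gt0 N_gt0 rhoM_def cLS.
rewrite ler_norml => /andP[_ rerr] ->.
rewrite EFinB; apply: leeB; last by rewrite lee_fin.
rewrite [(K / _)%R]mulrC EFinM; apply: lee_wpmul2l; first by rewrite lee_fin invr_ge0 ltW.
rewrite -lneK_expR lee_lne// itv_ge0// ?lee_fin ?expR_ge0//.
by rewrite (le_trans _ KM)// lee_fin expR_ge0.
Qed.

Lemma risk_gap_le K : M (alpha * loss_sd c) <= (expR K)%:E ->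
  risk_gap alpha rhoM c <= (K / alpha + err)%:E.
Proof.
move=> KM; have [r] := location_scale_gap xi_mean xi_second_moment
  alpha_gt0 N_gt0 rhoM_def cLS.
rewrite ler_norml => /andP[rerr _] ->.
rewrite EFinD; apply: leeD; last by rewrite -EFinN lee_fin lerNl.
rewrite [(K / _)%R]mulrC EFinM; apply: lee_wpmul2l; first by rewrite lee_fin invr_ge0 ltW.
rewrite -lneK_expR lee_lne// itv_ge0// ?lee_fin ?expR_ge0//.
by rewrite (le_trans _ (standardized_mgf_ge1 xi_mean xi_second_moment _)).
Qed.

End GapBounds.

(** * Bounds on moment generating functions *)

Section MgfLower.
Context {R : realType} {d : measure_display} {T : measurableType d}.
Context {P : probability T R} {X : T -> R}.
Hypothesis mX : measurable_fun setT X.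
Local Open Scope ereal_scope.

Lemma measurable_preimageT {B : set R} : measurable B -> measurable (X @^-1` B).
Proof. by move=> mB; rewrite -[_ @^-1` _]setTI; exact: mX. Qed.

Lemma measurable_expR_mul t : measurable_fun setT (fun w => (expR (t * X w))%:E).
Proof.
by apply/measurable_EFinP; apply: measurableT_comp => //; exact: measurable_funM.
Qed.

Lemma exp_moment_cell_ge {B : set R} {t k : R} : measurable B ->
    (forall x, B x -> k <= t * x)%R ->
  (expR k)%:E * P (X @^-1` B) <= \int[P]_(w in X @^-1` B) (expR (t * X w))%:E.
Proof.
move=> mB kB; rewrite -integral_cst; last exact: measurable_preimageT.
apply: ge0_le_integral => //.
- exact: measurable_preimageT.
- by move=> w _; rewrite lee_fin expR_ge0.
- by apply: measurable_funTS; exact: measurable_expR_mul.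
- by move=> w Bw; rewrite lee_fin ler_expR kB.
Qed.

Lemma mgf_ge_tail {t a : R} : (0 <= t)%R ->
  (expR (t * a))%:E * P [set w | a <= X w]%R <= 'E_P[fun w => expR (t * X w)].
Proof.
move=> t0; have mB : measurable [set x : R | a <= x]%R.
  by rewrite -set_itvcy; exact: measurable_itv.
apply: le_trans (exp_moment_cell_ge mB _) _.
  by move=> x; rewrite /= => ax; exact: ler_wpM2l.
rewrite unlock; apply: ge0_subset_integral => //.
- exact: (measurable_preimageT mB).
- exact: measurable_expR_mul.
Qed.

(** The law is given by a density g through a bare set function, as for the
    Laplace law; only the probabilities of cells [a, b[ are needed. *)
Lemma density_cell_ge {g : R -> R} {a b k : R} :
    has_law P X (fun B => \int[lebesgue_measure]_(x in B) (g x)%:E) ->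
    measurable_fun setT g -> (a < b)%R -> (0 <= k)%R ->
    (forall x, a <= x < b -> k <= g x)%R ->
  (k * (b - a))%:E <= P (X @^-1` `[a, b[%classic).
Proof.
move=> lawX mg ab k0 kg; rewrite lawX//.
rewrite (_ : (k * (b - a))%:E =
    \int[lebesgue_measure]_(x in `[a, b[%classic) k%:E); last first.
  by rewrite integral_cst//= lebesgue_measure_itv/= lte_fin ab -EFinB EFinM.
apply: ge0_le_integral => //.
by apply: measurable_funTS; exact/measurable_EFinP.
Qed.

(** The exponent of exp(t x) times the density peaks at a = m + t s^2.  Markov's
    inequality at a, with P(X >= a) bounded below by the mass of [a, a + s[,
    loses only a term linear in t compared with the exact value
    exp(t m + t^2 s^2 / 2). *)
Lemma normal_mgf_ge {m s t : R} : (0 < s)%R -> has_law P X (normal_prob m s) ->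
    (0 <= t)%R ->
  (s * normal_peak s *
    expR (t * m + t ^+ 2 * s ^+ 2 / 2 - t * s - 2^-1))%:E
  <= 'E_P[fun w => expR (t * X w)].
Proof.
move=> s0 lawX t0; have s_neq0 : (s != 0)%R by rewrite gt_eqF.
pose a := (m + t * s ^+ 2)%R.
(* On [a, a + s[ the density is smallest at the right end, where the distance
   to m is (t s + 1) s. *)
pose k := (normal_peak s * expR (- ((t * s + 1) ^+ 2 / 2)))%R.
have cell : (k * s)%:E <= P (X @^-1` `[a, (a + s)%R[%classic).
  have -> : (k * s = k * (a + s - a))%R by ring.
  apply: (density_cell_ge lawX).
  - exact: measurable_normal_pdf.
  - by rewrite ltrDl.
  - by rewrite mulr_ge0 ?normal_peak_ge0 ?expR_ge0.
  - move=> x /andP[ax xb]; rewrite normal_pdfE// /k ler_wpM2l ?normal_peak_ge0//.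
    rewrite /normal_fun ler_expR mulNr lerN2.
    rewrite ler_pdivrMr; last by rewrite pmulrn_lgt0// exprn_gt0.
    have -> : ((t * s + 1) ^+ 2 / 2 * (s ^+ 2 *+ 2) = ((t * s + 1) * s) ^+ 2)%R.
      by field.
    rewrite ler_pXn2r// ?nnegrE.
    + by move: xb; rewrite /a; nra.
    + by move: ax; rewrite /a => ?; have := sqr_ge0 s; nra.
    + by nra.
apply: le_trans (mgf_ge_tail (a := a) t0).
apply: (@le_trans _ _ ((expR (t * a))%:E * (k * s)%:E)).
  rewrite -EFinM lee_fin /k le_eqVlt; apply/orP; left; apply/eqP.
  rewrite [RHS](_ : _ = s * normal_peak s *
    (expR (t * a) * expR (- ((t * s + 1) ^+ 2 / 2))))%R; last by ring.
  by rewrite -expRD; congr (_ * expR _)%R; rewrite /a; field.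
rewrite lee_pmul2l// ?lte_fin ?expR_gt0//.
apply: le_trans cell _; apply: le_measure; rewrite ?inE.
- exact: measurable_preimageT.
- have mB : measurable [set x : R | a <= x]%R.
    by rewrite -set_itvcy; exact: measurable_itv.
  exact: (measurable_preimageT mB).
- by move=> w /=; rewrite in_itv/= => /andP[].
Qed.

(** On the cell [j, j + 1[ with j < n the integrand is at least a constant times
    exp((t - sqrt 2) j), and (t - sqrt 2) j >= - j / n >= - 1: each of the n
    cells contributes the same fixed amount. *)
Lemma laplace_mgf_ge {n : nat} {t : R} : (0 < n)%N -> standardized_laplace P X ->
    (0 <= t)%R -> (Num.sqrt 2 - n%:R^-1 <= t)%R ->
  (n%:R * ((Num.sqrt 2)^-1 * expR (- (1 + Num.sqrt 2))))%:E
  <= 'E_P[fun w => expR (t * X w)].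
Proof.
move=> n0 lawX t0 tn; set q := Num.sqrt 2 in tn lawX *.
have q0 : (0 < q)%R by rewrite sqrtr_gt0.
set C := (q^-1 * _)%R.
have cell (j : nat) : (j < n)%N -> C%:E <=
    \int[P]_(w in X @^-1` `[j%:R, j.+1%:R[%classic) (expR (t * X w))%:E.
  move=> jn; pose k := (q^-1 * expR (- (q * j.+1%:R)))%R.
  have kP : k%:E <= P (X @^-1` `[j%:R, j.+1%:R[%classic).
    rewrite -[k]mulr1 -[in X in X <= _](_ : j.+1%:R - j%:R = 1 :> R)%R; last first.
      by rewrite -natrB// subSnn.
    apply: (density_cell_ge lawX).
    - apply: measurable_funM => //; apply: measurableT_comp => //.
      apply: measurableT_comp => //; apply: measurable_funM => //.
    - by rewrite ltr_nat.
    - by rewrite mulr_ge0 ?expR_ge0// invr_ge0 ltW.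
    - move=> x /andP[jx xj]; rewrite ler_wpM2l ?invr_ge0 ?(ltW q0)//.
      rewrite ler_expR lerN2 ler_wpM2l ?(ltW q0)// ger0_norm; first exact: ltW.
      exact: le_trans jx.
  apply: le_trans (exp_moment_cell_ge (k := t * j%:R) _ _); last 2 first.
  - exact: measurable_itv.
  - by move=> x /=; rewrite in_itv/= => /andP[jx _]; exact: ler_wpM2l.
  apply: (@le_trans _ _ ((expR (t * j%:R))%:E * k%:E)); last first.
    by rewrite lee_pmul2l// lte_fin expR_gt0.
  rewrite -EFinM lee_fin /k mulrCA ler_wpM2l ?invr_ge0 ?(ltW q0)//.
  rewrite -expRD ler_expR -natr1.
  have jn1 : (n%:R^-1 * j%:R <= 1 :> R)%R.
    by rewrite ler_pdivrMl ?ltr0n// mulr1 ler_nat ltnW.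
  have : ((q - n%:R^-1) * j%:R <= t * j%:R)%R by rewrite ler_wpM2r.
  by rewrite mulrBl; lra.
have sum (j : nat) : (j <= n)%N -> (j%:R * C)%:E <=
    \int[P]_(w in X @^-1` `[0%R, j%:R[%classic) (expR (t * X w))%:E.
  elim: j => [_|j IH jn].
    by rewrite mul0r integral_ge0// => w _; rewrite lee_fin expR_ge0.
  have -> : X @^-1` `[0%R, j.+1%:R[%classic =
      X @^-1` `[0%R, j%:R[%classic `|` X @^-1` `[j%:R, j.+1%:R[%classic.
    apply/seteqP; split => w /=; rewrite !in_itv/=.
      by move=> /andP[-> ->]; case: (ltP (X w) j%:R); [left|right].
    case=> /andP[]; first by move=> -> /lt_trans -> //; rewrite ltr_nat.
    by move=> /(le_trans _) -> // ->.
  rewrite ge0_integral_setU//.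
  - have -> : (j.+1%:R * C = j%:R * C + C)%R by rewrite -natr1 mulrDl mul1r.
    by rewrite EFinD; apply: leeD; [exact/IH/ltnW|exact: cell].
  - exact: measurable_preimageT.
  - exact: measurable_preimageT.
  - by apply: measurable_funTS; exact: measurable_expR_mul.
  - apply/disj_setPS => w [] /=; rewrite !in_itv/= => /andP[_ lt] /andP[ge _].
    by move: lt; rewrite ltNge ge.
apply: le_trans (sum _ (leqnn n)) _.
rewrite unlock; apply: ge0_subset_integral => //.
- exact: measurable_preimageT.
- exact: measurable_expR_mul.
Qed.

End MgfLower.

Section MgfUpper.
Context {R : realType} {d : measure_display} {T : measurableType d}.
Context {P : probability T R} {X : T -> R}.
Hypothesis mX : measurable_fun setT X.
Local Open Scope ereal_scope.

(** When n <= |X w| < n + 1, the term of index n alone already dominates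
    exp(t X w). *)
Lemma mgf_le_shells {t : R} : (0 <= t)%R ->
  'E_P[fun w => expR (t * X w)] <=
  \sum_(n <oo) (expR (t * n.+1%:R))%:E * P [set w | n%:R <= `|X w|]%R.
Proof.
move=> t0; pose A n := [set w | n%:R <= `|X w|]%R.
have mA n : measurable (A n).
  have mB : measurable [set x : R | n%:R <= x]%R.
    by rewrite -set_itvcy; exact: measurable_itv.
  have mnX : measurable_fun setT (fun w => `|X w|%R) by exact: measurableT_comp.
  by have := mnX measurableT _ mB; rewrite setTI.
pose f n w := (expR (t * n.+1%:R))%:E * (\1_(A n) w)%:E.
have f0 n w : 0 <= f n w by rewrite mule_ge0 ?lee_fin ?expR_ge0.
have mf n : measurable_fun setT (f n).
  apply: emeasurable_funM => //; apply/measurable_EFinP.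
  exact: measurable_indic.
apply: (@le_trans _ _ (\int[P]_w \sum_(n <oo) f n w)).
  rewrite unlock; apply: ge0_le_integral => //.
  - exact: measurable_expR_mul.
  - exact: ge0_emeasurable_sum.
  - move=> w _; pose n := Num.truncn `|X w|%R.
    have /andP[nX Xn] := truncn_itv (normr_ge0 (X w)).
    apply: (@le_trans _ _ (f n w)).
      rewrite /f indicE mem_set// mule1 lee_fin ler_expR ler_wpM2l//.
      by rewrite (le_trans (ler_norm _))// ltW.
    rewrite (@nneseriesD1 _ _ n)//; apply: leeDl; exact: nneseries_ge0.
rewrite integral_nneseries//; apply: lee_nneseries.
  by move=> n _ _; exact: integral_ge0.
move=> n _; rewrite /f ge0_integralZl_EFin ?expR_ge0//.
- by rewrite integral_indic// setIT.
- by apply/measurable_EFinP; exact: measurable_indic.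
Qed.

(** In the shell bound t n <= n^2 / (2 c^2) + c^2 t^2 / 2, and half of the
    Gaussian decay exp(- n^2 / c^2) remains to make the series converge; it is
    majorized by the geometric series of ratio exp(- 1 / (2 c^2)). *)
Lemma subgaussian_mgf_le : subgaussian_tails P X ->
  exists k e : R, [/\ (0 <= k)%R, (0 <= e)%R & forall t, (0 <= t)%R ->
    'E_P[fun w => expR (t * X w)] <= (expR (k * t ^+ 2 + t + e))%:E].
Proof.
case=> c c0 tail.
pose q := expR (- (2 * c ^+ 2)^-1).
have q0 : (0 < q)%R by exact: expR_gt0.
have c2 : (0 < c ^+ 2)%R by exact: exprn_gt0.
have q1 : (q < 1)%R by rewrite -expR0 ltr_expR oppr_lt0 invr_gt0 mulr_gt0.
pose K := (2 * (1 - q)^-1)%R.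
have K2 : (1 <= K)%R.
  by rewrite /K ler_pdivlMr ?subr_gt0// mul1r; lra.
have K0 : (0 < K)%R by exact: lt_le_trans ltr01 K2.
exists (c ^+ 2 / 2)%R, (ln K); split.
- by rewrite divr_ge0// ltW.
- exact: ln_ge0.
move=> t t0; apply: le_trans (mgf_le_shells t0) _.
pose a := (2 * expR (c ^+ 2 / 2 * t ^+ 2 + t))%R.
have a0 : (0 <= a)%R by rewrite mulr_ge0 ?expR_ge0.
have term n : (expR (t * n.+1%:R))%:E * P [set w | n%:R <= `|X w|]%R <=
    (geometric a q n)%:E.
  apply: le_trans (lee_pmul _ _ (lexx _) (tail _ (ler0n _ n))) _ => //.
  rewrite -EFinM lee_fin /geometric /= /a /q -expRM_natl mulrCA -!mulrA.
  rewrite ler_pM2l// -!expRD ler_expR.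
  have nn : (n%:R <= n%:R ^+ 2 :> R)%R.
    by rewrite -natrX ler_nat -[leqLHS]muln1 -mulnn leq_mul2l; case: (n).
  (* This square is the inequality between t n and its two quadratic terms. *)
  have := sqr_ge0 (n%:R / c - c * t)%R.
  have -> : ((n%:R / c - c * t) ^+ 2 =
    n%:R ^+ 2 / c ^+ 2 + c ^+ 2 * t ^+ 2 - 2 * (t * n%:R))%R.
    by field; rewrite gt_eqF.
  have : (n%:R / c ^+ 2 <= n%:R ^+ 2 / c ^+ 2)%R.
    by rewrite ler_pM2r// invr_gt0.
  rewrite invfM mulrN [(n%:R * _)%R]mulrCA -[n.+1%:R]natr1 mulrDr mulr1.
  by lra.
apply: (@le_trans _ _ (\sum_(n <oo) (geometric a q n)%:E)).
  by apply: lee_nneseries => // n _ _; rewrite mule_ge0// lee_fin expR_ge0.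
have -> : expR (c ^+ 2 / 2 * t ^+ 2 + t + ln K) = (a * (1 - q)^-1)%R.
  by rewrite expRD lnK// /K /a; ring.
have g0 n : 0 <= (geometric a q n)%:E by rewrite lee_fin geometric_ge0// ltW.
apply: lime_le; first exact: is_cvg_nneseries.
near=> n; rewrite sumEFin lee_fin.
by apply: geometric_le_lim; rewrite // ger0_norm// ltW.
Unshelve. all: by end_near. Qed.

End MgfUpper.

(** * Growth of the standardized moment generating function *)

Section MgfGrowth.
Context {R : realType} {d : measure_display} {S : measurableType d}.
Context {Pxi : probability S R} {xi : {RV Pxi >-> R}}.
Context {d' : measure_display} {T : measurableType d'} {P : probability T R}.
Context {X : T -> R} {m s : R}.
Hypothesis mX : measurable_fun setT X.
Hypothesis s_gt0 : 0 < s.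
Hypothesis lawX : same_law P X Pxi (fun w => m + s * xi w).

Lemma standardized_mgfE t : ('E_Pxi[fun w => expR (t * xi w)] =
  (expR (- (t / s * m)))%:E * 'E_P[fun w => expR (t / s * X w)])%E.
Proof.
rewrite (same_law_affine_mgf mX lawX) muleA -EFinM -expRD addNr expR0 mul1e.
by rewrite divfK// gt_eqF.
Qed.

Hypothesis xi_mean : ('E_Pxi[xi] = 0)%E.
Hypothesis xi_second_moment : ('E_Pxi[fun s => (xi s ^+ 2)%R] = 1)%E.

Lemma normal_standardized_mgf_ge : normally_distributed P X ->
  exists k b, [/\ 0 < k, 0 <= b & forall t, 0 <= t ->
    ((expR (k * t ^+ 2 - b * (t + 1)))%:E <=
      'E_Pxi[fun w => expR (t * xi w)])%E].
Proof.
case=> [[a [v [v0 lawN]]]|[a lawD]]; last first.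
  (* A point mass has variance 0, whereas the variance of X is s^2 > 0. *)
  have : ((s ^+ 2)%:E = 0)%E.
    rewrite -(same_law_affine_variance xi_mean xi_second_moment mX lawX).
    rewrite /variance unlock; set e := fine _; rewrite unlock.
    have Ea : e = a.
      rewrite /e unlock (has_law_integral mX lawD (f := EFin)).
        by rewrite integral_dirac// diracT mul1e.
      exact/measurable_EFinP.
    have mf : measurable_fun setT (fun x : R => ((x - e) * (x - e))%:E).
      by apply/measurable_EFinP; apply: measurable_funM; exact: measurable_funB.
    rewrite [LHS](has_law_integral mX lawD mf) integral_dirac//.
    by rewrite Ea subrr mulr0 mule0.
  by case=> /eqP; rewrite expf_eq0/= gt_eqF.
pose h := v * normal_peak v.
have h0 : 0 < h by rewrite mulr_gt0// normal_peak_gt0// gt_eqF.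
pose b1 := (m + v - a) / s; pose b2 := 2^-1 - ln h.
exists ((v / s) ^+ 2 / 2), (`|b1| + `|b2|); split.
- by rewrite divr_gt0// exprn_gt0// divr_gt0.
- by rewrite addr_ge0.
move=> t t0; have ts0 : 0 <= t / s by rewrite divr_ge0// ltW.
rewrite standardized_mgfE.
apply: (@le_trans _ _ ((expR (- (t / s * m)))%:E * (h *
    expR (t / s * a + (t / s) ^+ 2 * v ^+ 2 / 2 - t / s * v - 2^-1))%:E)%E).
  rewrite -EFinM lee_fin -[h in leRHS]lnK// -!expRD ler_expR.
  have -> : - (t / s * m) + (ln h +
      (t / s * a + (t / s) ^+ 2 * v ^+ 2 / 2 - t / s * v - 2^-1)) =
      (v / s) ^+ 2 / 2 * t ^+ 2 - (b1 * t + b2).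
    by rewrite /b1 /b2; field; rewrite gt_eqF.
  have := ler_norm b1; have := ler_norm b2.
  have := normr_ge0 b1; have := normr_ge0 b2; nra.
by rewrite lee_pmul2l// ?lte_fin ?expR_gt0//; exact: normal_mgf_ge.
Qed.

Lemma subgaussian_standardized_mgf_le : subgaussian_tails P X ->
  exists k b, [/\ 0 <= k, 0 <= b & forall t, 0 <= t ->
    ('E_Pxi[fun w => expR (t * xi w)] <=
      (expR (k * t ^+ 2 + b * (t + 1)))%:E)%E].
Proof.
move=> /(subgaussian_mgf_le mX)[k [e [k0 e0 ke]]].
pose b1 := (1 - m) / s.
exists (k / s ^+ 2), (`|b1| + e); split.
- by rewrite divr_ge0// exprn_ge0// ltW.
- by rewrite addr_ge0.
move=> t t0; have ts0 : 0 <= t / s by rewrite divr_ge0// ltW.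
rewrite standardized_mgfE.
apply: (@le_trans _ _ ((expR (- (t / s * m)))%:E *
    (expR (k * (t / s) ^+ 2 + t / s + e))%:E)%E).
  by rewrite lee_pmul2l// ?lte_fin ?expR_gt0// ke.
rewrite -EFinM lee_fin -expRD ler_expR.
have -> : - (t / s * m) + (k * (t / s) ^+ 2 + t / s + e) =
    k / s ^+ 2 * t ^+ 2 + (b1 * t + e).
  by rewrite /b1; field; rewrite gt_eqF.
by have := ler_norm b1; have := normr_ge0 b1; nra.
Qed.

End MgfGrowth.

(** * The four regimes *)

Lemma quadratic_dominates {R : realType} {k b : R} : 0 < k -> 0 <= b ->
  exists2 sbar, 0 < sbar & forall s, sbar <= s -> b * (s + 1) <= k * s ^+ 2.
Proof.
move=> k0 b0; have bk : 0 <= b / k by rewrite divr_ge0// ltW.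
exists (1 + 2 * (b / k)); first by lra.
move=> s hs.
have ks : k + 2 * b <= k * s.
  have -> : k + 2 * b = k * (1 + 2 * (b / k)) by field; rewrite gt_eqF.
  by rewrite ler_pM2l.
by nra.
Qed.

Theorem proposition6 (R : realType) (alpha : R) (N : nat)
    (d : measure_display) (S : measurableType d) (Pxi : probability S R)
    (xi : {RV Pxi >-> R}) (rhoM : ('I_N -> R) -> R)
    (alpha_gt0 : 0 < alpha) (N_ge1 : (1 <= N)%N)
    (xi_mean : ('E_Pxi[xi] = 0)%E)
    (xi_second_moment : ('E_Pxi[fun s => (xi s ^+ 2)%R] = 1)%E)
    (rhoM_def : rhoM = rho_Delta alpha \/ rhoM = rho_OIC alpha) :
  let LS (c : decision R N) := location_scale Pxi xi (dec_problem c) in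
  [/\ unbounded_right_tail Pxi xi ->
        asymp_littleomega LS loss_sd (risk_gap alpha rhoM) loss_sd,
      asymp_bigOmega (fun c => LS c /\ losses_normal (dec_problem c))
        loss_sd (risk_gap alpha rhoM) loss_var,
      standardized_laplace Pxi xi ->
        tends_to_pinfty LS (risk_gap alpha rhoM) loss_var (2 / alpha ^+ 2)
    & asymp_bigO (fun c => LS c /\ losses_subgaussian (dec_problem c))
        loss_sd (fun c => `|risk_gap alpha rhoM c|%E) loss_var].
Proof.
move=> LS.
have N0 : 0 <= N%:R :> R by [].
have Na0 : 0 <= N%:R / alpha :> R by rewrite divr_ge0// ltW.
have ge_gap (c : decision R N) (cLS : LS c) :=
  risk_gap_ge xi_mean xi_second_moment alpha_gt0 N_ge1 rhoM_def cLS.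
have le_gap (c : decision R N) (cLS : LS c) :=
  risk_gap_le xi_mean xi_second_moment alpha_gt0 N_ge1 rhoM_def cLS.
have loss_law (c : decision R N) (cLS : LS c) :=
  location_scale_loss xi_mean xi_second_moment cLS.
split.
- move=> tail c c0.
  (* The tail bound grows like y s: y exceeds c by N to absorb the error of the
     estimator, and by 1 to absorb the constants when s is large. *)
  pose y := N%:R + c + 1.
  have [p p0 pE] : exists2 p : R, 0 < p & Pxi [set w | y <= xi w] = p%:E.
    have mB : measurable [set x : R | y <= x].
      by rewrite -set_itvcy; exact: measurable_itv.
    have := probability_le1 Pxi (measurable_preimageT (measurable_funPT xi) mB).
    have := tail y; rewrite /preimage/=.
    by case: (Pxi _) => [p||]//; rewrite lte_fin; exists p.
  exists (1 + `|N%:R / alpha - ln p / alpha|); first by rewrite ltr_pwDl.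
  move=> i iLS hi.
  have sd0 : 0 <= loss_sd i by exact: sqrtr_ge0.
  apply: le_trans (ge_gap i iLS (alpha * loss_sd i * y + ln p) _).
    rewrite lee_fin.
    have -> : (alpha * loss_sd i * y + ln p) / alpha =
      loss_sd i * y + ln p / alpha by field; rewrite gt_eqF.
    have := ler_norm (N%:R / alpha - ln p / alpha); rewrite /y; nra.
  have as0 : 0 <= alpha * loss_sd i by rewrite mulr_ge0// ltW.
  apply: le_trans (mgf_ge_tail (measurable_funPT xi) (a := y) as0).
  by rewrite pE expRD lnK// EFinM.
- have [[c0 [[c0LS c0N] c0sd]]|none] :=
      pselect (exists c, (LS c /\ losses_normal (dec_problem c)) /\ 0 < loss_sd c); last first.
    exists 1, 1; split => // i Di i1; exfalso; apply: none; exists i.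
    by split => //; exact: lt_le_trans i1.
  have [_ mX [m lawX]] := loss_law _ c0LS.
  have [k [b [k0 b0 kb]]] := normal_standardized_mgf_ge mX c0sd lawX
    xi_mean xi_second_moment (c0N _ (dec_feasible c0)).
  have ka0 : 0 < k * alpha / 2 by rewrite divr_gt0// mulr_gt0.
  have B0 : 0 <= b + b / alpha + N%:R + N%:R / alpha.
    by rewrite !addr_ge0// divr_ge0// ltW.
  have [sb sb0 hsb] := quadratic_dominates ka0 B0.
  exists (k * alpha / 2), sb; split => // i [iLS _] hi.
  have sd0 : 0 <= loss_sd i by exact: sqrtr_ge0.
  apply: le_trans (ge_gap i iLS _ (kb _ _)); last by rewrite mulr_ge0// ltW.
  have [-> _ _] := loss_law _ iLS; rewrite lee_fin; have := hsb _ hi; move: (loss_sd i) sd0 => x x0 hx.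
  have -> : (k * (alpha * x) ^+ 2 - b * (alpha * x + 1)) / alpha =
    k * alpha * x ^+ 2 - b * x - b / alpha by field; rewrite gt_eqF.
  have : 0 <= b / alpha by rewrite divr_ge0// ltW.
  by move: hx Na0; set u := N%:R / alpha; set v := b / alpha; nra.
- move=> lap K; set q := Num.sqrt 2 : R.
  have q0 : 0 < q by rewrite sqrtr_gt0.
  pose C := q^-1 * expR (- (1 + q)).
  have C0 : 0 < C by rewrite mulr_gt0 ?invr_gt0 ?expR_gt0.
  have v0E : Num.sqrt (2 / alpha ^+ 2) = q / alpha.
    by rewrite sqrtrM// sqrtrV ?exprn_ge0 ?(ltW alpha_gt0)// sqrtr_sqr gtr0_norm.
  (* exp L is the value of M that makes the gap at least K when the standard
     deviation is at most q / alpha + 1. *)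
  pose L := alpha * (K + N%:R * (q / alpha + 1) + N%:R / alpha).
  have [n n0 nL] : exists2 n, (0 < n)%N & expR L <= n%:R * C.
    exists (Num.truncn (expR L / C)).+1 => //.
    rewrite -ler_pdivrMr//; apply: ltW.
    by have /andP[] := truncn_itv (ltW (divr_gt0 (expR_gt0 L) C0)).
  (* alpha times e is at most 1 / n, which puts alpha s in the range of the
     Laplace bound. *)
  pose e := Num.min 1 (n%:R^-1 / alpha).
  have e0 : 0 < e.
    by rewrite !lt_min ltr01 !divr_gt0// invr_gt0 ltr0n.
  have /cvgrPdist_lt /(_ e e0) near_sqrt :=
    @sqrt_continuous R (2 / alpha ^+ 2).
  apply: filterS near_sqrt => v; rewrite v0E => ve _ i iLS vE.
  have sdE : loss_sd i = Num.sqrt v by rewrite /loss_sd vE.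
  rewrite -sdE in ve; move: ve.
  rewrite !lt_min => /andP[d1 d3].
  have as0 : 0 <= alpha * loss_sd i by rewrite mulr_ge0 ?sqrtr_ge0// ltW.
  have asn : q - n%:R^-1 <= alpha * loss_sd i.
    move: d3; rewrite ltr_norml => /andP[_].
    rewrite ltrBlDr -(ltr_pM2l alpha_gt0) mulrDr.
    by rewrite !(mulrCA alpha) !divff ?gt_eqF// !mulr1; lra.
  have mM := laplace_mgf_ge (measurable_funPT xi) n0 lap as0 asn.
  apply: le_trans (ge_gap i iLS L _); last first.
    by apply: le_trans mM; rewrite lee_fin.
  rewrite lee_fin /L; have -> : alpha * (K + N%:R * (q / alpha + 1) + N%:R / alpha) / alpha
    = K + N%:R * (q / alpha + 1) + N%:R / alpha by field; rewrite gt_eqF.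
  have : loss_sd i <= q / alpha + 1 by move: d1; rewrite ltr_norml; lra.
  by move=> /(ler_wpM2l N0); lra.
- have [[c0 [[c0LS c0N] c0sd]]|none] :=
      pselect (exists c, (LS c /\ losses_subgaussian (dec_problem c)) /\ 0 < loss_sd c); last first.
    exists 1, 1; split => // i Di i1; exfalso; apply: none; exists i.
    by split => //; exact: lt_le_trans i1.
  have [_ mX [m lawX]] := loss_law _ c0LS.
  have [k [b [k0 b0 kb]]] := subgaussian_standardized_mgf_le mX c0sd lawX
    (c0N _ (dec_feasible c0)).
  have ba0 : 0 <= b / alpha by rewrite divr_ge0// ltW.
  have B0 : 0 <= b + b / alpha + N%:R + N%:R / alpha by rewrite !addr_ge0.
  have [sb sb0 hsb] := quadratic_dominates ltr01 B0.
  have kal : 0 <= k * alpha by rewrite mulr_ge0// ltW.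
  exists (k * alpha + 1), sb; split => //; first by rewrite ltr_wpDl.
  move=> i [iLS _] hi.
  have sd0 : 0 <= loss_sd i by exact: sqrtr_ge0.
  have as0 : 0 <= alpha * loss_sd i by rewrite mulr_ge0// ltW.
  have hx := hsb _ hi.
  have up := le_gap i iLS _ (kb _ as0).
  have lo : ((0 / alpha - (N%:R * loss_sd i + N%:R / alpha))%:E <=
      risk_gap alpha rhoM i)%E.
    by apply: ge_gap => //; rewrite expR0 standardized_mgf_ge1.
  have [-> _ _] := loss_law _ iLS; move: hx up lo; move: (loss_sd i) sd0 => x x0 hx.
  case: (risk_gap _ _ _) => [r||]//; rewrite !lee_fin ler_norml mul0r => up lo.
  have k1 : (k * (alpha * x) ^+ 2 + b * (alpha * x + 1)) / alpha =
    k * alpha * x ^+ 2 + b * x + b / alpha by field; rewrite gt_eqF.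
  rewrite k1 in up.
  have kx : 0 <= k * alpha * x ^+ 2 by rewrite mulr_ge0// sqr_ge0.
  have bx : 0 <= b * x by rewrite mulr_ge0.
  have Nx : 0 <= N%:R * x by rewrite mulr_ge0.
  have ux : 0 <= (b / alpha) * x by rewrite mulr_ge0.
  have wx : 0 <= (N%:R / alpha) * x by rewrite mulr_ge0.
  move: hx up lo Na0 ba0 ux wx; set u := N%:R / alpha; set v := b / alpha.
  by rewrite !mulrDr !mulrDl; lra.
Qed.
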